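(* Let $X,Y,Z,W,S_{1},S_{2},S_{3}$ be normed spaces, let $f:X\times Y\times Z\to W$ and $g:S_{1}\times S_{2}\times S_{3}\to W$ be bounded tri-linear maps, and suppose that $f$ factors through $g$. If $g$ is regular, then $f$ is also regular.
   Context: For a bounded tri-linear $f:X\times Y\times Z\to W$, $f^{*}:W^{*}\times X\times Y\to Z^{*}$ is given by $\langle f^{*}(w^{*},x,y),z\rangle=\langle w^{*},f(x,y,z)\rangle$; iterating, $f^{**}=(f^{*})^{*}:Z^{**}\times W^{*}\times X\to Y^{*}$, $f^{***}=(f^{**})^{*}:Y^{**}\times Z^{**}\times W^{*}\to X^{*}$, $f^{****}=(f^{***})^{*}:X^{**}\times Y^{**}\times Z^{**}\to W^{**}$. The flip is $f^{r}(z,y,x)=f(x,y,z)$, and $f^{r****r}=((f^{r})^{****})^{r}:X^{**}\times Y^{**}\times Z^{**}\to W^{**}$. The map $f$ is regular if $f^{****}=f^{r****r}$. $f$ factors through $g$ if there are bounded linear mappings $h_{1}:X\to S_{1}$, $h_{2}:Y\to S_{2}$, $h_{3}:Z\to S_{3}$ with $f(x,y,z)=g(h_{1}(x),h_{2}(y),h_{3}(z))$ for all $x\in X$, $y\in Y$, $z\in Z$. *)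

(* Defs.v *)
(* MathComp / MathComp-Analysis, with R[i] from real-closed. *)
From HB Require Import structures.
From mathcomp Require Import all_boot all_order all_algebra.
From mathcomp Require Import all_classical all_reals.
From mathcomp Require Import topology normedtype.
From mathcomp.real_closed Require Import complex.

Set Implicit Arguments.
Unset Strict Implicit.
Unset Printing Implicit Defensive.

Import Order.TTheory GRing.Theory Num.Theory numFieldNormedType.Exports.
Local Open Scope classical_set_scope.
Local Open Scope ring_scope.

(* Normed spaces are taken over R or over C = R[i]; the two cases are treated
   uniformly. *)
Variant scalar_kind := RealScalars | ComplexScalars.

Definition scalars (R : realType) (k : scalar_kind) : numFieldType :=
  match k with RealScalars => R | ComplexScalars => R[i] end.

Lemma scalars_supremums (R : realType) (k : scalar_kind)
    (A : set (scalars R k)) (c : scalars R k) :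
  A !=set0 -> (forall a, A a -> 0 <= a) -> ubound A c -> supremums A !=set0.
Proof.
case: k A c => /= A c A0 Age0 Ac.
  exists (sup A); have supA : has_sup A by split=> //; exists c.
  by split; [exact: ub_le_sup supA.2 | move=> b Ab; exact: ge_sup].
have ImA a : A a -> complex.Im a = 0.
  by move/Age0; rewrite lecE => /andP[/eqP].
pose B := [set complex.Re a | a in A].
have B0 : B !=set0 by case: A0 => a Aa; exists (complex.Re a), a.
have ubB d : ubound A d -> ubound B (complex.Re d).
  by move=> Ad _ [a Aa <-]; have := Ad _ Aa; rewrite lecE => /andP[].
exists (Complex (sup B) 0); split.
  move=> a Aa; rewrite lecE/= ImA// eqxx/=.
  by apply: ub_le_sup; [exists (complex.Re c); exact: ubB | exists a].
move=> d Ad; have supBd : sup B <= complex.Re d by apply: ge_sup (ubB _ Ad).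
rewrite lecE/= supBd andbT; case: A0 => a Aa.
by have := Ad _ Aa; rewrite lecE (ImA a Aa) => /andP[].
Qed.

Section BoundedLinear.
Context {K : numFieldType}.

Definition bounded_linear (U V : normedModType K) (h : U -> V) : Prop :=
  linear h /\ exists M : K, forall x, `|h x| <= M * `|x|.

Record bounded_trilinear (X Y Z W : normedModType K) := BoundedTrilinear {
  trifun :> X -> Y -> Z -> W;
  trilinear1 : forall y z, linear (fun x => trifun x y z);
  trilinear2 : forall x z, linear (fun y => trifun x y z);
  trilinear3 : forall x y, linear (fun z => trifun x y z);
  tribounded : exists M : K, forall x y z,
    `|trifun x y z| <= M * `|x| * `|y| * `|z| }.

Lemma tribounded_ge0 (X Y Z W : normedModType K)
    (f : bounded_trilinear X Y Z W) :
  exists2 M : K, 0 <= M & forall x y z, `|f x y z| <= M * `|x| * `|y| * `|z|.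
Proof.
have [M fM] := tribounded f; exists `|M| => // x y z.
have p0 : 0 <= M * `|x| * `|y| * `|z| := le_trans (normr_ge0 _) (fM x y z).
by rewrite (le_trans (fM x y z))// -{1}(ger0_norm p0) !normrM !normr_id.
Qed.

End BoundedLinear.

Section Dual.
Context {R : realType} {k : scalar_kind}.
Local Notation K := (scalars R k).

Section Space.
Variable X : normedModType K.

Definition bounded_functional : {pred X -> K^o} :=
  fun u => `[< bounded_linear u >].

Record dual := Dual {
  dual_fun :> X -> K^o;
  dual_funP : dual_fun \in bounded_functional }.

HB.instance Definition _ := [isSub for dual_fun].
HB.instance Definition _ := [Choice of dual by <:].

Lemma bounded_functionalP (u : X -> K^o) :
  reflect (bounded_linear u) (u \in bounded_functional).
Proof. exact: asboolP. Qed.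

Lemma bounded_functional_submod : submod_closed bounded_functional.
Proof.
split.
  apply/bounded_functionalP; split.
    by move=> a x y; rewrite scaler0 addr0.
  by exists 0 => x; rewrite normr0 mul0r.
move=> c u v /bounded_functionalP[lu [M uM]] /bounded_functionalP[lv [N vN]].
apply/bounded_functionalP; split.
  move=> a x y /=.
  have E (z : X) : (c *: u + v) z = c *: u z + v z by [].
  by rewrite !E lu lv !scalerDr !scalerA (mulrC c a) addrACA.
exists (`|c| * M + N) => x.
rewrite mulrDl -mulrA (le_trans (ler_normD _ _))// lerD//.
by rewrite normrZ ler_wpM2l.
Qed.

HB.instance Definition _ :=
  GRing.isSubmodClosed.Build K (X -> K^o) bounded_functional
    bounded_functional_submod.
HB.instance Definition _ := [SubChoice_isSubLmodule of dual by <:].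

Lemma dual_linear (u : dual) : linear u.
Proof. by have /bounded_functionalP[] := dual_funP u. Qed.

HB.instance Definition _ (u : dual) :=
  GRing.isLinear.Build K X K^o _ (dual_fun u) (dual_linear u).

Lemma dual_ext (u v : dual) : (forall x, u x = v x) -> u = v.
Proof. by move=> uv; apply/val_inj/funext. Qed.

(* sup { |u x| : |x| <= 1 }; norms are K-valued, and for K = C the supremum is
   taken for the partial order of R[i], whose nonnegative elements are the
   nonnegative reals. *)
Definition dual_norm (u : dual) : K :=
  supremum 0 [set (`|u x| : K) | x in [set x : X | `|x| <= 1]].

Lemma dual_norm_lub (u : dual) :
  supremums [set (`|u x| : K) | x in [set x : X | `|x| <= 1]] (dual_norm u).
Proof.
have /bounded_functionalP[_ [M uM]] := dual_funP u.
have im0 : (`|u 0| : K) \in [set (`|u x| : K) | x in [set x : X | `|x| <= 1]].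
  by rewrite inE; exists 0 => //=; rewrite normr0.
rewrite /dual_norm /supremum; case: ifPn => [/eqP im|_].
  by rewrite im inE in im0.
apply: xgetPex; apply: (@scalars_supremums _ _ _ `|M|).
- by exists `|u 0|; rewrite inE in im0.
- by move=> _ [x _ <-].
- move=> _ [x /= x1 <-]; have := uM x.
  have [->|x0] := eqVneq x 0; first by rewrite linear0 normr0.
  have M0 : 0 <= M.
    have := le_trans (normr_ge0 _) (uM x).
    by rewrite pmulr_lge0// normr_gt0.
  by move=> /le_trans; apply; rewrite ger0_norm// ler_piMr.
Qed.

Lemma dual_norm_ge0 (u : dual) : 0 <= dual_norm u.
Proof.
apply: (le_trans (normr_ge0 (u 0))); apply: (dual_norm_lub u).1.
by exists 0 => //=; rewrite normr0.
Qed.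

Lemma dual_normP (u : dual) (x : X) : `|u x| <= dual_norm u * `|x|.
Proof.
have [->|x0] := eqVneq x 0; first by rewrite linear0 !normr0 mulr0.
have nx0 : 0 < `|x| by rewrite normr_gt0.
rewrite -ler_pdivrMr//.
apply: (dual_norm_lub u).1.
exists (`|x|^-1 *: x) => /=.
  by rewrite normrZ ger0_norm ?invr_ge0// mulVf// gt_eqF.
by rewrite linearZ/= normrZ ger0_norm ?invr_ge0// mulrC.
Qed.

Lemma dual_norm_le (u : dual) (c : K) :
  0 <= c -> (forall x, `|u x| <= c * `|x|) -> dual_norm u <= c.
Proof.
move=> c0 uc; apply: (dual_norm_lub u).2 => _ [x /= x1 <-].
by rewrite (le_trans (uc x))// ler_piMr.
Qed.

Lemma dual_normD (u v : dual) : dual_norm (u + v) <= dual_norm u + dual_norm v.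
Proof.
apply: dual_norm_le => [|x]; first by rewrite addr_ge0 ?dual_norm_ge0.
rewrite mulrDl (le_trans (ler_normD (u x) (v x)))//.
by rewrite lerD ?dual_normP.
Qed.

Let dual_normZ_le (a : K) (u : dual) :
  dual_norm (a *: u) <= `|a| * dual_norm u.
Proof.
apply: dual_norm_le => [|x]; first by rewrite mulr_ge0 ?dual_norm_ge0.
have -> : (a *: u) x = a *: u x by [].
by rewrite normrZ -mulrA ler_wpM2l ?dual_normP.
Qed.

Lemma dual_normZ (a : K) (u : dual) : dual_norm (a *: u) = `|a| * dual_norm u.
Proof.
apply/eqP; rewrite eq_le dual_normZ_le/=.
have [->|a0] := eqVneq a 0; first by rewrite normr0 mul0r dual_norm_ge0.
rewrite -{1}(scalerK a0 u) (le_trans (ler_wpM2l _ (dual_normZ_le _ _)))//.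
by rewrite normfV mulrA mulfV ?mul1r// normr_eq0.
Qed.

Lemma dual_norm_eq0 (u : dual) : dual_norm u = 0 -> u = 0.
Proof.
move=> u0; apply: dual_ext => x; apply/eqP.
by rewrite -normr_le0 (le_trans (dual_normP u x))// u0 mul0r.
Qed.

HB.instance Definition _ :=
  Lmodule_isNormed.Build K dual dual_normD dual_normZ dual_norm_eq0.

Lemma dual_norm_bound (u : dual) (x : X) : `|u x| <= `|u| * `|x|.
Proof. exact: dual_normP. Qed.

End Space.

Section Adjoint.
Variables X Y Z W : normedModType K.
Variable f : bounded_trilinear X Y Z W.

Lemma adjoint_subproof (w : dual W) (x : X) (y : Y) :
  (fun z : Z => w (f x y z)) \in @bounded_functional Z.
Proof.
apply/bounded_functionalP; split.
  by move=> a z z'; rewrite trilinear3 linearP.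
have [M fM] := tribounded f; exists (`|w| * (M * `|x| * `|y|)) => z.
by rewrite (le_trans (dual_norm_bound _ _))// -[leRHS]mulrA ler_wpM2l.
Qed.

Definition adjoint_fun (w : dual W) (x : X) (y : Y) : dual Z :=
  Dual (adjoint_subproof w x y).

Lemma adjoint_linear1 x y : linear (fun w => adjoint_fun w x y).
Proof. by move=> a w w'; apply: dual_ext. Qed.

Lemma adjoint_linear2 w y : linear (fun x => adjoint_fun w x y).
Proof.
by move=> a x x'; apply: dual_ext => z /=; rewrite trilinear1 linearP.
Qed.

Lemma adjoint_linear3 w x : linear (fun y => adjoint_fun w x y).
Proof.
by move=> a y y'; apply: dual_ext => z /=; rewrite trilinear2 linearP.
Qed.

Lemma adjoint_bounded : exists M : K, forall w x y,
  `|adjoint_fun w x y| <= M * `|w| * `|x| * `|y|.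
Proof.
have [M M0 fM] := tribounded_ge0 f; exists M => w x y.
apply: dual_norm_le => [|z]; first by rewrite !mulr_ge0.
rewrite (le_trans (dual_norm_bound w (f x y z)))//.
by rewrite [M * _]mulrC -!mulrA ler_wpM2l// !mulrA.
Qed.

(* <f^* (w, x, y), z> = <w, f (x, y, z)> *)
Definition adjoint : bounded_trilinear (dual W) X Y (dual Z) :=
  BoundedTrilinear adjoint_linear1 adjoint_linear2 adjoint_linear3
    adjoint_bounded.

Lemma flip_bounded : exists M : K, forall z y x,
  `|f x y z| <= M * `|z| * `|y| * `|x|.
Proof.
have [M fM] := tribounded f; exists M => z y x.
by rewrite -!mulrA [`|z| * _]mulrC -!mulrA [`|y| * _]mulrCA !mulrA.
Qed.

Definition flip : bounded_trilinear Z Y X W :=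
  @BoundedTrilinear _ Z Y X W (fun z y x => f x y z)
    (fun y x => trilinear3 f x y) (fun z x => trilinear2 f x z)
    (fun z y => trilinear1 f y z) flip_bounded.

End Adjoint.

Definition adjoint4 (X Y Z W : normedModType K)
    (f : bounded_trilinear X Y Z W) :
    bounded_trilinear (dual (dual X)) (dual (dual Y)) (dual (dual Z))
      (dual (dual W)) :=
  adjoint (adjoint (adjoint (adjoint f))).

Definition regular (X Y Z W : normedModType K)
    (f : bounded_trilinear X Y Z W) : Prop :=
  forall (x : dual (dual X)) (y : dual (dual Y)) (z : dual (dual Z)),
    adjoint4 f x y z = flip (adjoint4 (flip f)) x y z.

Definition factors_through (X Y Z W S1 S2 S3 : normedModType K)
    (f : bounded_trilinear X Y Z W) (g : bounded_trilinear S1 S2 S3 W) : Prop :=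
  exists (h1 : X -> S1) (h2 : Y -> S2) (h3 : Z -> S3),
    [/\ bounded_linear h1, bounded_linear h2, bounded_linear h3
      & forall x y z, f x y z = g (h1 x) (h2 y) (h3 z)].

End Dual.

(* Main.v *)
Require Import Defs.
From mathcomp Require Import all_boot all_order all_algebra.
From mathcomp Require Import all_classical all_reals.
From mathcomp Require Import topology normedtype.

(** Taking adjoints is natural.  A bounded linear [h : U -> V] has a transpose
    [h^t : V^* -> U^*], and if [f (x, y, z) = q (g (h1 x, h2 y, h3 z))] then
    [f^* (w, x, y) = h3^t (g^* (q^t w, h1 x, h2 y))], which is a factorization
    of the same shape ([adjoint_natural]).  Each adjoint moves the outer map to
    the first argument and the third map to the outside, transposing both, so
    after four adjoints every map is back in its place and has been transposed
    twice ([adjoint4_natural]):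
      [f^**** (x, y, z) = q^tt (g^**** (h1^tt x, h2^tt y, h3^tt z))].
    The flips of [f] and [g] satisfy the same hypothesis with [h1] and [h3]
    exchanged, hence both Arens extensions of [f] are obtained from those of [g]
    through the same maps [h1^tt], [h2^tt], [h3^tt] and [q^tt] (here [q] is the
    identity), and they agree as soon as those of [g] do. *)

Set Implicit Arguments.
Unset Strict Implicit.
Unset Printing Implicit Defensive.

Import Order.TTheory GRing.Theory Num.Theory numFieldNormedType.Exports.
Local Open Scope ring_scope.

Lemma bounded_linear_ge0 (K : numFieldType) (U V : normedModType K)
    (h : U -> V) : bounded_linear h ->
  exists2 M : K, 0 <= M & forall x, `|h x| <= M * `|x|.
Proof.
move=> [_ [M hM]]; exists `|M| => // x.
have Mx_ge0 : 0 <= M * `|x| := le_trans (normr_ge0 _) (hM x).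
by rewrite (le_trans (hM x))// -{1}(ger0_norm Mx_ge0) normrM normr_id.
Qed.

Lemma bounded_linear_id (K : numFieldType) (U : normedModType K) :
  bounded_linear (@id U).
Proof. by split=> //; exists 1 => x; rewrite mul1r. Qed.

Section Transpose.
Context {R : realType} {k : scalar_kind}.
Local Notation K := (scalars R k).
Variables (U V : normedModType K) (h : U -> V).
Hypothesis hP : bounded_linear h.

Lemma transpose_subproof (w : dual V) :
  (fun x : U => w (h x)) \in @bounded_functional R k U.
Proof.
apply/bounded_functionalP; split.
  by move=> a x y; rewrite hP.1 linearP.
have [M _ hM] := bounded_linear_ge0 hP; exists (`|w| * M) => x.
by rewrite (le_trans (dual_norm_bound _ _))// -[leRHS]mulrA ler_wpM2l.
Qed.

Definition transpose (w : dual V) : dual U := Dual (transpose_subproof w).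

Lemma bounded_linear_transpose : bounded_linear transpose.
Proof.
split; first by move=> a w w'; apply: dual_ext.
have [M M0 hM] := bounded_linear_ge0 hP; exists M => w.
apply: dual_norm_le => [|x]; first by rewrite mulr_ge0.
rewrite (le_trans (dual_norm_bound w (h x)))//.
by rewrite [M * _]mulrC -mulrA ler_wpM2l.
Qed.

End Transpose.

Section Naturality.
Context {R : realType} {k : scalar_kind}.
Local Notation K := (scalars R k).

Definition bitranspose (U V : normedModType K) (h : U -> V)
    (hP : bounded_linear h) : dual (dual U) -> dual (dual V) :=
  transpose (bounded_linear_transpose hP).

(** The outer map [q] makes the hypothesis stable under taking adjoints, so that
    the lemma can be iterated. *)
Lemma adjoint_natural (X Y Z W S1 S2 S3 T : normedModType K)
    (f : bounded_trilinear X Y Z W) (g : bounded_trilinear S1 S2 S3 T)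
    (h1 : X -> S1) (h2 : Y -> S2) (h3 : Z -> S3) (q : T -> W)
    (h3P : bounded_linear h3) (qP : bounded_linear q) :
  (forall x y z, f x y z = q (g (h1 x) (h2 y) (h3 z))) ->
  forall w x y,
    adjoint f w x y = transpose h3P (adjoint g (transpose qP w) (h1 x) (h2 y)).
Proof. by move=> fg w x y; apply: dual_ext => z /=; rewrite fg. Qed.

Lemma adjoint4_natural (X Y Z W S1 S2 S3 T : normedModType K)
    (f : bounded_trilinear X Y Z W) (g : bounded_trilinear S1 S2 S3 T)
    (h1 : X -> S1) (h2 : Y -> S2) (h3 : Z -> S3) (q : T -> W)
    (h1P : bounded_linear h1) (h2P : bounded_linear h2)
    (h3P : bounded_linear h3) (qP : bounded_linear q) :
  (forall x y z, f x y z = q (g (h1 x) (h2 y) (h3 z))) ->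
  forall x y z, adjoint4 f x y z =
    bitranspose qP (adjoint4 g (bitranspose h1P x) (bitranspose h2P y)
                              (bitranspose h3P z)).
Proof.
move=> fg.
have fg1 := adjoint_natural h3P qP fg.
have fg2 := adjoint_natural h2P (bounded_linear_transpose h3P) fg1.
have fg3 := adjoint_natural h1P (bounded_linear_transpose h2P) fg2.
exact: adjoint_natural (bounded_linear_transpose qP)
  (bounded_linear_transpose h1P) fg3.
Qed.

End Naturality.

Theorem corollary4 (R : realType) (k : scalar_kind)
    (X Y Z W S1 S2 S3 : normedModType (scalars R k))
    (f : bounded_trilinear X Y Z W) (g : bounded_trilinear S1 S2 S3 W) :
  factors_through f g -> regular g -> regular f.
Proof.
move=> [h1 [h2 [h3 [h1P h2P h3P fg]]]] greg x y z.
have idP := bounded_linear_id W.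
have flip_fg z0 y0 x0 :
    flip f z0 y0 x0 = flip g (h3 z0) (h2 y0) (h1 x0) by exact: fg.
rewrite (adjoint4_natural (q := id) h1P h2P h3P idP fg) greg.
exact/esym/(adjoint4_natural (q := id) h3P h2P h1P idP flip_fg).
Qed.
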